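(* Let $G$ be a finite non-cyclic abelian group with $$G\cong\mathbb{Z}_{p_1^{t_{11}}}\times\cdots\times\mathbb{Z}_{p_1^{t_{1k_1}}}\times\mathbb{Z}_{p_2^{t_{21}}}\times\cdots\times\mathbb{Z}_{p_2^{t_{2k_2}}}\times\cdots\times\mathbb{Z}_{p_r^{t_{r1}}}\times\cdots\times\mathbb{Z}_{p_r^{t_{rk_r}}}\times\mathbb{Z}_{p_{r+1}^{t_{r+1,1}}}\times\mathbb{Z}_{p_{r+2}^{t_{r+2,1}}}\times\cdots\times\mathbb{Z}_{p_s^{t_{s1}}},$$ where $p_1,\dots,p_s$ are distinct primes, all exponents are positive integers, and $k_i\ge 2$ and $1\le t_{i1}\le t_{i2}\le\cdots\le t_{ik_i}$ for all $i\in\{1,\dots,r\}$. Then $$\kappa(\mathcal{G}_E(G))\le p_{r+1}^{t_{r+1,1}}p_{r+2}^{t_{r+2,1}}\cdots p_s^{t_{s1}}\left(p_1^{t_{11}}p_2^{t_{21}}\cdots p_r^{t_{r1}}-\phi\big(p_1^{t_{11}}p_2^{t_{21}}\cdots p_r^{t_{r1}}\big)\right).$$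
   Context: For a group $G$, the enhanced power graph $\mathcal{G}_E(G)$ is the simple graph with vertex set $G$ in which two distinct elements $x,y$ are adjacent if and only if there is $w\in G$ with $x,y\in\langle w\rangle$. The vertex connectivity $\kappa(\Gamma)$ is the minimum number of vertices whose removal leaves a disconnected induced subgraph (the complete graph on $n$ vertices has vertex connectivity $n-1$). $\phi$ is Euler's totient function. $\mathbb{Z}_n$ is the cyclic group of order $n$. An empty product equals $1$ (the case $s=r$, when $G$ has no cyclic Sylow subgroup); since $G$ is non-cyclic, $r\ge 1$. *)

(* Defs.v *)
From HB Require Import structures.
From mathcomp Require Import all_boot all_fingroup all_algebra all_solvable.

Set Implicit Arguments.
Unset Strict Implicit.
Unset Printing Implicit Defensive.

Local Open Scope group_scope.

(* A graph is given by a vertex set V : {set T} and an adjacency e : rel T, of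
   which only the restriction to V matters. *)
Section Graphs.

Variables (T : finType) (e : rel T).
Implicit Types V X : {set T}.

Definition induced V : rel T := [rel x y | [&& x \in V, y \in V & e x y]].

Definition disconnected V :=
  [exists x in V, exists y in V, ~~ connect (induced V) x y].

Definition separating V X := (X \subset V) && disconnected (V :\: X).

Definition complete_on V := [forall x in V, forall y in V, (x != y) ==> e x y].

(* Complete graphs have no separating set, and any separating set has at most
   #|V| - 2 elements; see the two lemmas below. *)
Definition vertex_connectivity V : nat :=
  \big[minn/#|V|.-1]_(X : {set T} | separating V X) #|X|.

Lemma separating_complete V X : complete_on V -> ~~ separating V X.
Proof.
move=> /forall_inP cV; apply/negP => /andP[_ /exists_inP[x xV]].
case/exists_inP=> y yV /negP; case; have [->|nxy] := eqVneq x y.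
  exact: connect0.
apply: connect1; rewrite /induced /= xV yV /=.
move: xV yV; rewrite !inE => /andP[_ xV] /andP[_ yV].
by have /forall_inP/(_ y yV)/implyP := cV x xV; apply.
Qed.

Lemma vertex_connectivity_complete V :
  complete_on V -> vertex_connectivity V = #|V|.-1.
Proof.
by move=> cV; rewrite /vertex_connectivity big_pred0 // => X;
   apply/negbTE/separating_complete.
Qed.

Lemma vertex_connectivity_min V X :
  separating V X -> vertex_connectivity V <= #|X|.
Proof.
rewrite /vertex_connectivity -big_filter => sX.
have: X \in [seq Y <- index_enum {set T} | separating V Y].
  by rewrite mem_filter sX mem_index_enum.
elim: [seq _ <- _ | _] => //= Y s IHs; rewrite inE big_cons.
case/orP=> [/eqP <-|/IHs]; first exact: geq_minl.
exact: leq_trans (geq_minr _ _).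
Qed.

Lemma vertex_connectivity_attained V :
  ~~ complete_on V -> exists2 X, separating V X & #|X| = vertex_connectivity V.
Proof.
move=> /forall_inPn[x xV /forall_inPn[y yV]]; rewrite negb_imply => /andP[nxy ne].
have sep0 : separating V (V :\: [set x; y]).
  rewrite /separating subsetDl setDDr setDv set0U.
  have -> : V :&: [set x; y] = [set x; y].
    by apply/setIidPr; rewrite subUset !sub1set xV yV.
  apply/exists_inP; exists x; first by rewrite !inE eqxx.
  apply/exists_inP; exists y; first by rewrite !inE eqxx orbT.
  apply/negP => /connectP[q pq def_y].
  suff /(_ q pq) E : forall q, path (induced [set x; y]) x q -> last x q = x.
    by move: nxy; rewrite def_y E eqxx.
  elim=> //= z q' IH /andP[/and3P[_ /set2P[->|->]]] //.
  by rewrite (negbTE ne).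
have lt0 : #|V :\: [set x; y]| <= #|V|.-1.
  rewrite (cardsD1 x V) xV /= subset_leq_card //.
  by apply/subsetP => z; rewrite !inE negb_or => /andP[/andP[-> _] ->].
have [[X sX cX]|E] : (exists2 X, separating V X & #|X| = vertex_connectivity V)
    \/ vertex_connectivity V = #|V|.-1.
- rewrite /vertex_connectivity.
  elim/big_ind: _ => [|m n IHm IHn|X sX]; [by right| |by left; exists X].
  by rewrite /minn; case: ifP.
- by exists X.
exists (V :\: [set x; y]) => //.
by apply/eqP; rewrite eqn_leq vertex_connectivity_min // E lt0.
Qed.

End Graphs.

Definition enhanced_power_graph (gT : finGroupType) (G : {set gT}) : rel gT :=
  [rel x y | (x != y) && [exists w in G, (x \in <[w]>) && (y \in <[w]>)]].

(* The 'Z_n carry their additive group structure, and {dffun _} the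
   componentwise one. Meaningful only when all n i j >= 2 ('Z_0 and 'Z_1 have
   two elements). *)
Definition cyclic_product (s : nat) (k : 'I_s -> nat) (n : 'I_s -> nat -> nat) :=
  [set: {dffun forall u : {i : 'I_s & 'I_(k i)}, 'Z_(n (tag u) (tagged u))}].

(* Main.v *)
Require Import Defs.
From HB Require Import structures.
From mathcomp Require Import all_boot all_fingroup all_algebra all_solvable.

(** Let H be the product of the non-cyclic Sylow subgroups of G and K the
    product of the cyclic ones, so that G is the direct product of H and K, and
    n := #|K| is the first factor of the bound. Let x be the element of H whose
    coordinate is a generator in the smallest cyclic factor Z_{p_i^t_{i1}} of
    each Sylow subgroup of H, and 0 in the others; its order is m.

    The point is that <x> is a maximal cyclic subgroup of H
    ([first_gen_maximal]): if x were a power of some w in H generating a larger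
    subgroup, the exponent would be divisible by some p_i dividing the order of
    H, and then the coordinate of x in Z_{p_i^t_{i1}} would be divisible by p_i,
    hence not a generator.

    Remove from the enhanced power graph the products a * l where l is in K and
    a is a non-generator of <x>: there are (m - totient m) * n of them. Take a
    remaining product b * l where b generates <x>. If it lies in a common cyclic
    subgroup <w> with d * l', then projecting to H puts b and d in <w_H>, where
    w_H is the H-component of w; as <x> is maximal cyclic, <w_H> = <x>, so d is
    in <x>, and d is again a generator unless d * l' was removed. Hence the
    remaining part of <x>K is a union of components. It contains x but not the
    elements of H outside <x>, which exist because G is not cyclic. This is
    [vertex_connectivity_maximal_cyclic], which holds for every direct product
    of finite groups. *)

Set Implicit Arguments.
Unset Strict Implicit.
Unset Printing Implicit Defensive.

(** * Separating a direct product along a maximal cyclic subgroup *)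

Section DirectProduct.
Local Open Scope group_scope.

(** The element a is the H-component of w; as the two components of w commute,
    projecting the powers of w to H gives powers of a. *)
Lemma dprod_cycle_proj (gT : finGroupType) (G H K : {group gT}) (w : gT) :
    H \x K = G -> w \in G ->
  exists2 a, a \in H &
    forall b l, b \in H -> l \in K -> b * l \in <[w]> -> b \in <[a]>.
Proof.
case/dprodP=> _ <- cHK tiHK /mulsgP[a c Ha Kc ->]; exists a => // b l Hb Kl.
case/cycleP=> n; rewrite expgMn => [Ebl|]; last exact/commute_sym/(centsP cHK).
by rewrite -(divgrMid tiHK Hb Kl) Ebl divgrMid ?groupX ?cycle_id.
Qed.

(** The set removed consists of the products of a non-generator of <x> with an
    element of K. No path then leaves <x>K, because an edge from a generator of
    <x> times an element of K projects to a cyclic subgroup of H that contains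
    x. *)
Lemma vertex_connectivity_maximal_cyclic
    (gT : finGroupType) (G H K : {group gT}) (x : gT) :
    H \x K = G -> x \in H -> {in H, forall w, x \in <[w]> -> w \in <[x]>} ->
    ~~ (H \subset <[x]>) ->
  vertex_connectivity (enhanced_power_graph G) G
    <= #|K| * (#[x] - totient #[x]).
Proof.
move=> defG Hx max_x /subsetPn[y Hy x'y].
have [_ defHK _ tiHK] := dprodP defG.
have sHG : H \subset G by rewrite -defHK mulG_subl.
have sxH : <[x]> \subset H by rewrite cycle_subG.
have mem_mulK (A : {set gT}) b l : A \subset H -> b \in H -> l \in K ->
    (b * l \in A * K) = (b \in A).
  move=> sAH Hb Kl; apply/mulsgP/idP=> [[a c Aa Kc Ebl]|Ab]; last by exists b l.
  by rewrite -(divgrMid tiHK Hb Kl) Ebl divgrMid // (subsetP sAH).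
(* The H-components of the separating set. *)
pose N := <[x]> :\: [set z | generator <[x]> z].
have sNH : N \subset H := subset_trans (subsetDl _ _) sxH.
have mem_NK a : a \in H -> (a \in N * K) = (a \in N).
  by move=> Ha; rewrite -{1}[a]mulg1 mem_mulK.
have cardN : #|N| = #[x] - totient #[x].
  rewrite cardsD totient_gen orderE; congr (_ - #|pred_of_set _|).
  by apply/setIidPr/subsetP=> z; rewrite inE; apply: cycle_generator.
have sepX : separating (enhanced_power_graph G) G (N * K).
  rewrite /separating -{1}defHK mulSg //=; apply/exists_inP; exists x.
    by rewrite inE mem_NK // !inE generator_cycle (subsetP sHG).
  apply/exists_inP; exists y.
    by rewrite inE mem_NK // !inE (negbTE x'y) andbF (subsetP sHG).
  (* x and y are told apart by the invariant set <x>K. *)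
  set e := induced _ _.
  have sym_e : connect_sym e.
    apply/sym_connect_sym => u v; rewrite /e /induced /enhanced_power_graph /=.
    rewrite andbCA eq_sym; do 3!congr (_ && _).
    by apply: eq_existsb => w; rewrite [X in _ && X]andbC.
  have cl_e : closed e (mem (<[x]> * K)).
    apply: intro_closed => // u v /and3P[/setDP[Gu NKu] /setDP[Gv _]].
    case/andP=> _ /exists_inP[w Gw /andP[wu wv]].
    have [b [l [Hb Kl Eu _]]] := mem_dprod defG Gu.
    have [d [m [Hd Km Ev _]]] := mem_dprod defG Gv.
    have [a Ha proj_w] := dprod_cycle_proj defG Gw.
    rewrite {}Eu {}Ev in NKu wu wv *.
    rewrite !mem_mulK // in NKu * => xb.
    (* b was not removed, so it generates <x>. *)
    have Exb : <[x]> = <[b]>.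
      by apply/eqP; move: NKu; rewrite !inE xb andbT negbK.
    have xa : x \in <[a]>.
      by rewrite -cycle_subG Exb cycle_subG; apply: proj_w wu.
    have sax : <[a]> \subset <[x]> by rewrite cycle_subG max_x.
    by apply: (subsetP sax); apply: proj_w wv.
  apply/negP => /(closed_connect cl_e).
  rewrite -[x \in _]/(x \in <[x]> * K) -[y \in _]/(y \in <[x]> * K).
  rewrite -{1}[x]mulg1 -[y]mulg1 !mem_mulK // cycle_id => /esym; exact/negP.
apply: leq_trans (vertex_connectivity_min sepX) _.
rewrite -cardN mulnC -cardsX [N * K]curry_imset2X; exact: leq_imset_card.
Qed.

End DirectProduct.

(** * Products of cyclic groups of prime power order *)

Lemma dvdn_prod_coprime (I : eqType) (r : seq I) (P : pred I) (F : I -> nat) a :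
    uniq r -> {in r &, forall i j, i != j -> coprime (F i) (F j)} ->
  (\prod_(i <- r | P i) F i %| a) = all (fun i => P i ==> (F i %| a)) r.
Proof.
elim: r => [|i r IHr] /= => [|/andP[r'i Ur] coF].
  by rewrite big_nil dvd1n.
rewrite big_cons -IHr //; last first.
  by move=> j l rj rl; apply: coF; rewrite inE ?rj ?rl orbT.
case: ifP => //= _; rewrite Gauss_dvd //; rewrite big_seq_cond.
elim/big_rec: _ => [|j m /andP[rj _] co_m]; first exact: coprimen1.
rewrite coprimeMr co_m andbT coF ?inE ?eqxx ?rj ?orbT //.
by apply: contraNneq r'i => ->.
Qed.

Lemma pnat_prod (I : Type) (r : seq I) (P : pred I) (F : I -> nat)
    (pi : nat_pred) :
  (forall i, P i -> pi.-nat (F i)) -> pi.-nat (\prod_(i <- r | P i) F i).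
Proof.
by move=> piF; elim/big_rec: _ => // i a Pi pi_a; rewrite pnatM piF.
Qed.

Section Order.
Local Open Scope group_scope.

Lemma dvdn_order_dffun (I : finType) (gT : I -> finGroupType)
    (f : {dffun forall i, gT i}) a :
  (#[f] %| a) = [forall i, #[f i] %| a].
Proof.
have fX i : (f ^+ a) i = f i ^+ a :=
  morphX (@dffun_morphism I gT i) a (in_setT f).
apply/idP/forallP => [fa i|fa]; rewrite order_dvdn.
  by rewrite -fX (eqP (_ : f ^+ a == 1)) -?order_dvdn // ffunE.
by apply/eqP/ffunP=> i; rewrite fX ffunE; apply/eqP; rewrite -order_dvdn.
Qed.

End Order.

Section PrimePowerProduct.
Local Open Scope group_scope.
Local Open Scope nat_scope.

Variables (s : nat) (p k : 'I_s -> nat) (t : 'I_s -> nat -> nat).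
Hypotheses (p_prime : forall i, prime (p i)) (p_inj : injective p).
Hypotheses (k_gt0 : forall i, 0 < k i).
Hypothesis t_gt0 : forall (i : 'I_s) (j : nat), j < k i -> 0 < t i j.

Notation idx := {i : 'I_s & 'I_(k i)}.
Notation D :=
  {dffun forall u : idx, 'Z_(p (tag u) ^ t (tag u) (tagged u))}.

Let pt_gt1 (u : idx) : 1 < p (tag u) ^ t (tag u) (tagged u).
Proof.
by rewrite -(exp1n (t (tag u) (tagged u))) ltn_exp2r ?t_gt0 ?prime_gt1.
Qed.

(** In additive terms: 1 in the first cyclic factor of each p_i-part with i in
    A, and 0 elsewhere. *)
Definition first_gen (A : pred 'I_s) : D :=
  [ffun u : idx => if A (tag u) && (tagged u == 0 :> nat) then Zp1 else 1%g].

Let ord_first i : 'I_(k i) := Ordinal (k_gt0 i).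

Lemma order_first_gen A : #[first_gen A] = \prod_(i | A i) p i ^ t i 0.
Proof.
(* Both numbers have the same multiples. *)
have dvE a : (#[first_gen A] %| a) = (\prod_(i | A i) p i ^ t i 0 %| a).
  rewrite dvdn_order_dffun dvdn_prod_coprime ?index_enum_uniq //; last first.
    move=> i j _ _ neq_ij; rewrite coprimeXl ?coprimeXr //.
    by rewrite prime_coprime // dvdn_prime2 // (inj_eq p_inj).
  have order_coord (u : idx) : #[first_gen A u] =
      if A (tag u) && (tagged u == 0 :> nat)
      then p (tag u) ^ t (tag u) 0 else 1.
    rewrite ffunE; case: ifP => [/andP[_ /eqP <-]|_]; last exact: order1.
    by rewrite order_Zp1 Zp_cast.
  apply/forallP/allP => [dv i _ | dv u].
    apply/implyP=> Ai; have := dv (Tagged (fun i => 'I_(k i)) (ord_first i)).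
    by rewrite order_coord /= Ai.
  rewrite order_coord; case: ifP => [/andP[Au _] | _]; last exact: dvd1n.
  by apply: (implyP (dv _ _)) => //; apply: mem_index_enum.
by apply/eqP; rewrite eqn_dvd -(dvE #[_]) (dvE (\prod_(i | A i) _)) !dvdnn.
Qed.

(** Write the element as w ^+ a; it generates <w> unless a shares a prime factor
    p_i with the order of w, and then its coordinate of index (i, 0) is p_i
    times something, contradicting that this coordinate generates its factor. *)
Lemma first_gen_maximal (A : pred 'I_s) (pi : nat_pred) (w : D) :
    (forall q, q \in pi -> exists2 i, A i & q = p i) -> pi.-elt w ->
  first_gen A \in <[w]> -> w \in <[first_gen A]>.
Proof.
move=> piA pi_w /cycleP[a Ea]; rewrite Ea.
suff: generator <[w]> (w ^+ a) by move/eqP <-; apply: cycle_id.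
rewrite generator_coprime; apply: contraT; rewrite /coprime => nco.
have gcd_gt1 : 1 < gcdn #[w] a.
  by rewrite ltn_neqAle eq_sym nco gcdn_gt0 order_gt0.
have:= pdiv_dvd (gcdn #[w] a); rewrite dvdn_gcd => /andP[dvw dva].
have [|i Ai Eq] := piA (pdiv (gcdn #[w] a)).
  by apply: (pnatPpi pi_w); rewrite mem_primes pdiv_prime // order_gt0.
rewrite {}Eq in dva.
pose u : idx := Tagged (fun i => 'I_(k i)) (ord_first i).
have wX b : (w ^+ b) u = w u ^+ b :=
  morphX (@dffun_morphism _ _ u) b (in_setT w).
have ti0 : 0 < t i 0 by apply: t_gt0.
(* This order is also p i ^ t i 0, as (w ^+ a) u is the unit Zp1. *)
have : #[(w ^+ a) u] %| p i ^ (t i 0).-1.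
  rewrite order_dvdn wX -expgM -order_dvdn.
  have /dvdn_trans : #[w u] %| p i ^ t i 0.
    have := order_dvdG (in_setT (w u)).
    by rewrite cardsT card_ord Zp_cast // (pt_gt1 u).
  by apply; rewrite -(prednK ti0) expnS dvdn_mul.
rewrite -Ea ffunE /= Ai /= order_Zp1 Zp_cast ?(pt_gt1 u) //.
by rewrite dvdn_Pexp2l ?prime_gt1 // leqNgt prednK // leqnn.
Qed.

Lemma card_prime_power_product :
  #|[set: D]| = \prod_i \prod_(j < k i) p i ^ t i j.
Proof.
rewrite cardsT card_dep_ffun foldrE big_map big_enum /= sig_big_dep /=.
by apply: eq_bigr => u _; rewrite card_ord Zp_cast.
Qed.

End PrimePowerProduct.

(** * The bound for abelian groups *)

Theorem theorem5p3 (gT : finGroupType) (G : {group gT})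
    (r s : nat) (p k : 'I_s -> nat) (t : 'I_s -> nat -> nat)
    (abelG : abelian G) (ncycG : ~~ cyclic G)
    (le_rs : r <= s)
    (p_prime : forall i, prime (p i)) (p_inj : injective p)
    (k_ge2 : forall i : 'I_s, i < r -> 2 <= k i)
    (k_eq1 : forall i : 'I_s, r <= i -> k i = 1)
    (t_gt0 : forall (i : 'I_s) (j : nat), j < k i -> 0 < t i j)
    (t_mono : forall (i : 'I_s) (j l : nat),
        i < r -> j <= l -> l < k i -> t i j <= t i l)
    (isoG : G \isog cyclic_product k (fun i j => p i ^ t i j)) :
  let m := \prod_(i < s | i < r) p i ^ t i 0 in
  vertex_connectivity (enhanced_power_graph G) G
    <= (\prod_(i < s | r <= i) p i ^ t i 0) * (m - totient m).
Proof.
lazy zeta; set m := \prod_(i < s | i < r) _.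
set n := \prod_(i < s | r <= i) _.
have nilG := abelian_nil abelG.
have k_gt0 i : 0 < k i.
  by have [/k_ge2/ltnW | /k_eq1->] := ltnP i r.
have{isoG} [f injf imf] := isogP isoG; rewrite /cyclic_product in f injf imf.
have preim_f y : exists2 z, z \in G & f z = y.
  have: y \in (f @* G)%g by rewrite imf in_setT.
  by case/morphimP=> z _ Gz ->; exists z.
have cardG : #|G| = \prod_i \prod_(j < k i) p i ^ t i j.
  by rewrite -(card_injm injf (subxx G)) imf card_prime_power_product.
pose pi : nat_pred := [pred q | [exists i : 'I_s, (i < r) && (q == p i)]].
have pi_p i : (p i \in pi) = (i < r).
  apply/existsP/idP => [[j /andP[lt_jr /eqP/p_inj->]] | lt_ir] //.
  by exists i; rewrite lt_ir eqxx.
have cardpi' : #|'O_pi^'(G)%g| = n.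
  rewrite (card_Hall (nilpotent_pcore_Hall _ nilG)) cardG.
  rewrite (bigID (fun i : 'I_s => i < r)) /=.
  rewrite partnM ?prodn_cond_gt0 // => [|i _|i _]; last 2 first.
  - by rewrite prodn_gt0 // => j; rewrite expn_gt0 prime_gt0.
  - by rewrite prodn_gt0 // => j; rewrite expn_gt0 prime_gt0.
  rewrite part_p'nat ?pnatNK ?mul1n; last first.
    apply: pnat_prod => i lt_ir; apply: pnat_prod => j _.
    by rewrite pnatX pnatE ?pi_p ?lt_ir.
  rewrite part_pnat_id; last first.
    apply: pnat_prod => i le_ri; apply: pnat_prod => j _.
    by rewrite pnatX pnatE // inE /= pi_p le_ri.
  apply: eq_big => [i | i]; rewrite -leqNgt // => le_ri.
  by rewrite k_eq1 // big_ord1.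
have [x Gx fx] := preim_f (first_gen p k t (fun i => i < r)).
(* If <x> were all of the pi-part, <c> would be all of G. *)
have [c Gc fc] := preim_f (first_gen p k t predT).
have ord_x : #[x]%g = m by rewrite -(order_injm injf) // fx order_first_gen.
have ord_c : #[c]%g = m * n.
  rewrite -(order_injm injf) // fc order_first_gen //.
  rewrite (bigID (fun i : 'I_s => i < r)) /=; congr (_ * _).
  by apply: eq_bigl => i; rewrite -leqNgt.
have mem_pi :=
  mem_normal_Hall (nilpotent_pcore_Hall pi nilG) (pcore_normal _ _).
have pi_x : pi.-elt%g x.
  rewrite /p_elt ord_x; apply: pnat_prod => i lt_ir.
  by rewrite pnatX pnatE ?pi_p ?lt_ir.
rewrite -cardpi' -ord_x.
apply: (vertex_connectivity_maximal_cyclic (nilpotent_pcoreC pi nilG)).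
- by rewrite mem_pi.
- move=> w Ow xw; have Gw := subsetP (pcore_sub _ _) _ Ow.
  have pi_w : pi.-elt%g w by rewrite -mem_pi.
  have: f x \in <[f w]>%g by rewrite -morphim_cycle // mem_morphim.
  rewrite fx => /(first_gen_maximal p_prime k_gt0 t_gt0).
  move=> /(_ pi) max_w.
  suff: f w \in (f @* <[x]>)%g.
    by case/morphimP => z Gz xz /(injmP injf) ->.
  rewrite morphim_cycle // fx; apply: max_w; last exact: morph_p_elt.
  by move=> q /existsP[i /andP[lt_ir /eqP->]]; exists i.
apply: contra ncycG => sOx; apply/cyclicP; exists c; apply/eqP.
rewrite eq_sym eqEcard cycle_subG Gc /= -orderE ord_c.
rewrite -(dprod_card (nilpotent_pcoreC pi nilG)) cardpi' leq_mul //.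
by rewrite -ord_x orderE subset_leq_card.
Qed.
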